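(* (a) For each positive integer $s$, we have $L(s^2+s+1)=\frac{s+1}{s^2+s+1}$ if and only if a projective plane of order $s$ exists. Furthermore, if $D$ is a covering design with $s^2+s+1$ blocks and at most $s^2+s+1$ points such that $L(D)=\frac{s+1}{s^2+s+1}$, then $D$ is a projective plane of order $s$. (b) For each integer $s \geq 2$, we have $L(s^2+s)=\frac{1}{s}$ if and only if either an affine plane of order $s$ exists or an almost projective plane of order $s$ exists. If $D$ is a covering design with $s^2+s$ blocks and at most $s^2$ points such that $L(D)=\frac{1}{s}$, then $D$ is an affine plane of order $s$.
   Context: A hypergraph is a pair $(X,\mathcal{E})$ with $X$ a finite set and $\mathcal{E}$ a finite multiset of subsets of $X$; it is $k$-uniform if every edge has size $k$. A covering design is a hypergraph $(X,\mathcal{B})$ (points $X$, blocks $\mathcal{B}$) such that every pair of distinct points lies together in at least one block. A linear space is a covering design in which every pair of distinct points lies in exactly one block. A projective plane of order $s$ ($s\ge 1$) is an $(s+1)$-uniform linear space with $s^2+s+1$ points and $s^2+s+1$ blocks. An affine plane of order $s$ ($s\ge 2$) is an $s$-uniform linear space with $s^2$ points and $s^2+s$ blocks. An almost projective plane of order $s$ is an $(s+1)$-uniform covering design with $s^2+s$ points and $s^2+s$ blocks in which each point lies in exactly $s+1$ blocks. A weighting of a finite set $S$ is an assignment of nonnegative reals to its elements; for $S'\subseteq S$, $w(S')=\sum_{x\in S'}w(x)$; $w$ is normalised if $w(S)=1$. For a covering design $D=(X,\mathcal{B})$ and normalised weighting $w$ of $X$, $L(D,w)=\max\{w(B):B\in\mathcal{B}\}$;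 $L(D)$ is the infimum of $L(D,w)$ over all normalised weightings $w$ of $X$; and for a positive integer $m$, $L(m)$ is the infimum of $L(D)$ over all covering designs $D$ with exactly $m$ blocks (counted with multiplicity).
   Formalization: A covering design is also required to have every point in at least one block; this excludes only one-point hypergraphs whose blocks are all empty, which would otherwise make L(m) = 0 for every m and the statement false. *)

(* Defs.v *)
From HB Require Import structures.
From mathcomp Require Import all_boot all_order all_algebra.
From mathcomp Require Import all_classical all_reals all_analysis.

Set Implicit Arguments.
Unset Strict Implicit.
Unset Printing Implicit Defensive.

Import Order.TTheory GRing.Theory Num.Theory.

Local Open Scope classical_set_scope.
Local Open Scope ring_scope.

(* The multiset of blocks is represented by a sequence: every notion below
   counts blocks with multiplicity and is invariant under permutation. *)
Record hypergraph := Hypergraph {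
  point : finType;
  blocks : seq {set point}
}.

Definition npoints (D : hypergraph) : nat := #|point D|.

Definition nblocks (D : hypergraph) : nat := size (blocks D).

Definition uniform (k : nat) (D : hypergraph) : Prop :=
  forall B : {set point D}, B \in blocks D -> #|B| = k.

Definition degree (D : hypergraph) (x : point D) : nat :=
  count (fun B : {set point D} => x \in B) (blocks D).

Definition codegree (D : hypergraph) (x y : point D) : nat :=
  count (fun B : {set point D} => (x \in B) && (y \in B)) (blocks D).

(* The first clause follows from the second as soon as there are two points.
   It only excludes the one-point hypergraphs all of whose blocks are empty:
   there the condition on pairs is void and every block has weight 0, so that
   admitting them would make L(m) = 0 for every m. *)
Definition covering_design (D : hypergraph) : Prop :=
  (forall x : point D, (0 < degree x)%N) /\
  (forall x y : point D, x <> y -> (0 < codegree x y)%N).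

Definition linear_space (D : hypergraph) : Prop :=
  covering_design D /\
  (forall x y : point D, x <> y -> codegree x y = 1%N).

Definition projective_plane (s : nat) (D : hypergraph) : Prop :=
  [/\ (1 <= s)%N, linear_space D, uniform s.+1 D,
      npoints D = (s ^ 2 + s + 1)%N & nblocks D = (s ^ 2 + s + 1)%N].

Definition affine_plane (s : nat) (D : hypergraph) : Prop :=
  [/\ (2 <= s)%N, linear_space D, uniform s D,
      npoints D = (s ^ 2)%N & nblocks D = (s ^ 2 + s)%N].

Definition almost_projective_plane (s : nat) (D : hypergraph) : Prop :=
  [/\ covering_design D, uniform s.+1 D,
      npoints D = (s ^ 2 + s)%N, nblocks D = (s ^ 2 + s)%N &
      forall x : point D, degree x = s.+1].

Definition weight (R : realType) (T : finType) (w : T -> R) (A : {set T}) : R :=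
  \sum_(x in A) w x.

Definition weighting (R : realType) (T : finType) (w : T -> R) : Prop :=
  forall x, 0 <= w x.

Definition normalised (R : realType) (T : finType) (w : T -> R) : Prop :=
  weighting w /\ weight w [set: T]%SET = 1.

(* L(D, w). As weights are nonnegative, the default value 0 does not affect the
   maximum over a nonempty collection of blocks. *)
Definition max_block_weight (R : realType) (D : hypergraph)
    (w : point D -> R) : R :=
  \big[Num.max/0]_(B <- blocks D) weight w B.

(* L(D). The infimum is taken in the extended reals, so that it is +oo for a
   hypergraph without points, which has no normalised weighting. *)
Definition Ldesign (R : realType) (D : hypergraph) : \bar R :=
  ereal_inf [set (max_block_weight w)%:E
            | w in [set w : point D -> R | normalised w]].

(* L(m). Written with "exists" because the type of hypergraphs lives in too large
   a universe to be the type of elements of a classical set. *)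
Definition Lnum (R : realType) (m : nat) : \bar R :=
  ereal_inf [set l : \bar R | exists D : hypergraph,
               [/\ covering_design D, nblocks D = m & l = Ldesign R D]].

(* Main.v *)
(** Let [w] be a normalised weighting with all block weights at most [L]. The blocks
    through a point [x] cover everything, so [1 + (deg x - 1) w x <= deg x * L];
    for the values of [L] at hand every [x] of positive weight has degree at
    least [s + 1]. Counting [\sum_B w B = \sum_x deg x * w x] in two ways then shows
    that these degrees are all [s + 1], that every block has weight exactly [L], and
    that no point is heavier than the uniform weight of the plane. With few points
    [w] is thus uniform and every pair of points lies on one block.

    [L(m)] is attained by compactness. At an optimum, moving the weights inside
    the kernel of the incidence matrix removes points until the incidence vectors of
    the points are linearly independent, so that there are at most [m] points. This
    settles the projective case. In the affine case, weighting the pairs that meet a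
    block shows that all blocks have at least [s] points. If none has exactly [s], the
    design is an almost projective plane. A block with [s] points, together with the
    blocks disjoint from it, partitions the points; [c <= s] pairwise meeting blocks of
    this kind yield [c] linear relations between blocks, hence at most [m - c] points,
    hence more than [c * s] blocks of size [s], hence a further such block meeting the
    previous ones. For [c = s] there are at most [s ^ 2] points. *)
Require Import Defs.
From HB Require Import structures.
From mathcomp Require Import all_boot all_order all_algebra.
From mathcomp Require Import all_classical all_reals all_analysis.
From mathcomp Require Import ring lra zify.

Set Implicit Arguments.
Unset Strict Implicit.
Unset Printing Implicit Defensive.

Import Order.TTheory GRing.Theory Num.Theory.

Local Open Scope ring_scope.

(** * Double counting of weights over an indexed family of blocks *)

Section IndexedBlocks.
Variables (R : realType) (T I : finType) (B : I -> {set T}).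
Implicit Types (w v : T -> R) (x y : T) (i j : I).

(** The diagonal value [codeg x x] is the degree of [x], so positivity for all pairs, equal points
    included, expresses both clauses of a covering design. *)
Definition codeg x y : nat := (\sum_i (x \in B i) * (y \in B i))%N.

Definition feasible (L : R) w : Prop :=
  normalised w /\ forall i, weight w (B i) <= L.

Lemma codegC x y : codeg x y = codeg y x.
Proof. by apply: eq_bigr => i _; rewrite mulnC. Qed.

Lemma codegxx x : codeg x x = (\sum_i (x \in B i))%N.
Proof. by apply: eq_bigr => i _; rewrite mulnb andbb. Qed.

Lemma sum_weight (a : I -> nat) w :
  \sum_i (a i)%:R * weight w (B i)
    = \sum_y (\sum_i a i * (y \in B i))%N%:R * w y.
Proof.
transitivity (\sum_i \sum_y (a i * (y \in B i))%N%:R * w y).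
  apply: eq_bigr => i _; rewrite /weight big_mkcond mulr_sumr.
  by apply: eq_bigr => y _; case: ifP => _; rewrite ?muln1 ?muln0 ?mulr0 ?mul0r.
by rewrite exchange_big; apply: eq_bigr => y _; rewrite natr_sum mulr_suml.
Qed.

Lemma sum_weight_point x w :
  \sum_i (x \in B i)%:R * weight w (B i) = \sum_y (codeg x y)%:R * w y.
Proof. exact: sum_weight. Qed.

Lemma sum_weight_all w :
  \sum_i weight w (B i) = \sum_y (codeg y y)%:R * w y.
Proof.
rewrite (eq_bigr (fun i => 1%N%:R * weight w (B i))); last by move=> i _; rewrite mul1r.
rewrite sum_weight; apply: eq_bigr => y _; rewrite codegxx.
by congr (_%:R * _); apply: eq_bigr => i _; rewrite mul1n.
Qed.

Lemma sum_normalised w : normalised w -> \sum_x w x = 1.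
Proof.
by case=> _; rewrite /weight => <-; apply: eq_bigl => x; rewrite inE.
Qed.

Hypothesis cov : forall x y, (0 < codeg x y)%N.

(** Every point other than [x] is counted at least once, and [x] itself as often as its degree. *)
Lemma codeg_weight_ge x w : normalised w ->
  1 + ((codeg x x)%:R - 1) * w x <= \sum_y (codeg x y)%:R * w y.
Proof.
move=> nw; have [w0 _] := nw.
have := sum_normalised nw; rewrite (bigD1 x) //= [leRHS](bigD1 x) //=.
have : \sum_(y | y != x) w y <= \sum_(y | y != x) (codeg x y)%:R * w y.
  by apply: ler_sum => y _; rewrite ler_peMl // ler1n.
lra.
Qed.

Lemma degree_weight_le (L : R) x w : feasible L w ->
  1 + ((codeg x x)%:R - 1) * w x <= (codeg x x)%:R * L.
Proof.
move=> [nw wL]; apply: le_trans (codeg_weight_ge x nw) _.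
rewrite -sum_weight_point codegxx natr_sum mulr_suml.
by apply: ler_sum => i _; rewrite ler_wpM2l.
Qed.

(** * Equality case of the double counting *)

Section Tight.
Variables (s : nat) (L c : R) (w : T -> R).
Hypothesis IL : #|I|%:R * L = s.+1%:R.
Hypothesis Lc : s.+1%:R * L = 1 + s%:R * c.
Hypothesis s_gt0 : (0 < s)%N.
Hypothesis c_ge0 : 0 <= c.
Hypothesis fw : feasible L w.
Hypothesis degw : forall x, 0 < w x -> (s < codeg x x)%N.

Let nw := fw.1.
Let w0 : forall x, 0 <= w x := nw.1.

(** Both sums measure a deviation from the plane, in degrees and in block weights. Each has
    nonnegative terms, so all terms vanish. *)
Let sum_defect :
  \sum_x ((codeg x x)%:R - s.+1%:R) * w x + \sum_i (L - weight w (B i)) = 0.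
Proof.
rewrite sumrB sum_weight_all sumr_const -[L *+ _]mulr_natl IL.
under eq_bigr => x _ do rewrite mulrBl.
rewrite sumrB -mulr_sumr (sum_normalised nw) mulr1.
by rewrite addrA subrK subrr.
Qed.

Let deg_defect x : 0 <= ((codeg x x)%:R - s.+1%:R) * w x.
Proof.
have [/degw h|h] := ltP 0 (w x); first by rewrite mulr_ge0 // subr_ge0 ler_nat.
by rewrite (_ : w x = 0) ?mulr0 //; apply/eqP; rewrite eq_le h w0.
Qed.

Lemma tight_degree x : 0 < w x -> codeg x x = s.+1.
Proof.
move=> wx; have /eqP := sum_defect.
rewrite paddr_eq0; first last.
- by apply: sumr_ge0 => i _; rewrite subr_ge0 fw.2.
- exact: sumr_ge0.
case/andP; rewrite psumr_eq0 // => /allP/(_ x).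
rewrite mem_index_enum mulf_eq0 (gt_eqF wx) orbF subr_eq0 eqr_nat.
by move=> /(_ isT)/eqP.
Qed.

Lemma tight_block i : weight w (B i) = L.
Proof.
have /eqP := sum_defect; have L0 j : 0 <= L - weight w (B j) by rewrite subr_ge0 fw.2.
rewrite paddr_eq0; [|exact: sumr_ge0|exact: sumr_ge0].
case/andP=> _; rewrite psumr_eq0 // => /allP/(_ i).
by rewrite mem_index_enum subr_eq0 => /(_ isT)/eqP.
Qed.

Lemma tight_codeg_sum x : 0 < w x -> \sum_y (codeg x y)%:R * w y = s.+1%:R * L.
Proof.
move=> wx; rewrite -sum_weight_point -(tight_degree wx) codegxx natr_sum mulr_suml.
by apply: eq_bigr => i _; rewrite tight_block.
Qed.

(** For [w x] positive, [codeg_weight_ge] now reads [1 + s * w x <= s.+1 * L], and [Lc] makes the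
    right side [1 + s * c]. *)
Lemma tight_weight_le x : w x <= c.
Proof.
have [wx|/le_trans -> //] := ltP 0 (w x).
have := codeg_weight_ge x nw.
rewrite (tight_codeg_sum wx) (tight_degree wx) Lc lerD2l -natr1 addrK.
by rewrite ler_pM2l // ltr0n.
Qed.

Section FewPoints.
Variable N : nat.
Hypothesis Nc : N%:R * c = 1.
Hypothesis TN : (#|T| <= N)%N.

(** At most [N] weights, none above [c = 1 / N], can sum to 1 only if all of them equal [c]. *)
Lemma tight_weight_eq x : w x = c.
Proof.
have : \sum_y (c - w y) <= 0.
  rewrite sumrB (sum_normalised nw) sumr_const -[c *+ _]mulr_natl subr_le0 -[leRHS]Nc.
  by apply: ler_wpM2r => //; rewrite ler_nat.
have cw y : 0 <= c - w y by rewrite subr_ge0 tight_weight_le.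
move=> le0; have : \sum_y (c - w y) == 0 by rewrite eq_le le0 sumr_ge0.
rewrite psumr_eq0 // => /allP/(_ x); rewrite mem_index_enum subr_eq0.
by move=> /(_ isT)/eqP.
Qed.

Let c_gt0 : 0 < c.
Proof.
rewrite lt_neqAle c_ge0 andbT eq_sym; apply/eqP => c0.
by move: Nc; rewrite c0 mulr0 => /esym/eqP; rewrite oner_eq0.
Qed.

Lemma tight_card : #|T| = N.
Proof.
apply/eqP; rewrite -(eqr_nat R) -(inj_eq (mulIf (lt0r_neq0 c_gt0))) Nc.
apply/eqP; rewrite -[RHS](sum_normalised nw) mulr_natl -sumr_const.
by apply: eq_bigr => x _; rewrite tight_weight_eq.
Qed.

Lemma tight_block_card i : #|B i|%:R = N%:R * L.
Proof.
rewrite -(tight_block i) /weight (eq_bigr (fun=> c)); last first.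
  by move=> x _; exact: tight_weight_eq.
by rewrite sumr_const -[c *+ _]mulr_natl mulrCA Nc mulr1.
Qed.

(** With uniform weights [codeg_weight_ge] is an equality at [x], so no other point is counted more
    than once. *)
Lemma tight_codeg x y : x != y -> codeg x y = 1%N.
Proof.
move=> xy; have wx : 0 < w x by rewrite tight_weight_eq.
have := sum_normalised nw; rewrite (bigD1 x) //= tight_weight_eq => h1.
have := tight_codeg_sum wx.
rewrite Lc (bigD1 x) //= (tight_degree wx) tight_weight_eq -natr1 => h2.
have : \sum_(z | z != x) ((codeg x z)%:R - 1) * w z = 0.
  under eq_bigr => z _ do rewrite mulrBl mul1r.
  rewrite sumrB; move: h1 h2; lra.
move/eqP; rewrite psumr_eq0; last first.
  by move=> z _; rewrite mulr_ge0 // subr_ge0 ler1n.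
move=> /allP/(_ y); rewrite mem_index_enum eq_sym xy /= mulf_eq0.
rewrite tight_weight_eq (gt_eqF c_gt0) orbF subr_eq0 (eqr_nat R _ 1).
by move=> /(_ isT)/eqP.
Qed.

End FewPoints.
End Tight.
End IndexedBlocks.

(** * Linear independence of points and reduction of the support *)

(** The hypothesis says that the rows of the point-block incidence matrix, restricted to the columns
    in [A], are independent; the rank is at most the number of columns. *)
Lemma card_le_blocks (R : realType) (T I : finType) (B : I -> {set T}) (A : {set I}) :
  (forall v : T -> R, (forall i, i \in A -> weight v (B i) = 0) ->
    forall x, v x = 0) ->
  (#|T| <= #|A|)%N.
Proof.
move=> inj.
pose M : 'M[R]_(#|T|, #|A|) := \matrix_(a, k) (enum_val a \in B (enum_val k))%:R.
suff /eqP <- : row_free M by exact: rank_leq_col.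
apply: inj_row_free => u uM; apply/rowP => a; rewrite mxE.
rewrite -[a]enum_valK; move: (enum_val a); apply: inj => i iA.
have /rowP/(_ (enum_rank_in iA i)) := uM.
rewrite !mxE => {1}<-; rewrite /weight big_mkcond /=.
rewrite [RHS](reindex enum_rank) /=; last exact/onW_bij/enum_rank_bij.
apply: eq_bigr => x _; rewrite mxE enum_rankK enum_rankK_in //.
by case: (x \in B i); rewrite ?mulr1 ?mulr0.
Qed.

(** The condition on the total mass is there because a weighting can be moved along a [v] violating
    this property without losing its normalisation. *)
Definition independent (R : realType) (T I : finType) (B : I -> {set T}) : Prop :=
  forall v : T -> R, \sum_x v x = 0 -> (forall i, weight v (B i) = 0) ->
    forall x, v x = 0.

Lemma perturb_to_zero (R : realType) (T : finType) (w v : T -> R) (x0 : T) :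
  (forall x, 0 < w x) -> \sum_x v x = 0 -> v x0 != 0 ->
  exists (t : R) (x : T),
    (forall y, 0 <= w y + t * v y) /\ w x + t * v x = 0.
Proof.
move=> w0 sv vx0.
have [x1 vx1] : exists x, v x < 0.
  apply: contrapT => /forallNP nv; case/negP: vx0.
  have v0 x : 0 <= v x by rewrite leNgt; apply/negP/nv.
  by move/eqP: sv; rewrite psumr_eq0 // => /allP/(_ x0); rewrite mem_index_enum; exact.
(* As in the simplex method, the least ratio gives the first coordinate to reach zero when moving
   along [v]. *)
case: (@arg_minP _ R T x1 (fun x => v x < 0) (fun x => w x / - v x) vx1) => x vx minx.
exists (w x / - v x), x; split=> [y|]; last first.
  by rewrite invrN mulrN mulNr divfK ?lt_eqF // subrr.
have t0 : 0 <= w x / - v x by rewrite divr_ge0 ?oppr_ge0 ?ltW.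
have [vy|vy] := ltP (v y) 0; last by apply: addr_ge0; [exact: ltW|exact: mulr_ge0].
by have := minx y vy; rewrite ler_pdivlMr ?oppr_gt0 // mulrN lerNl -subr_ge0 opprK addrC.
Qed.

(** Induction on a bound [n] for the number of points. A point of weight zero is deleted; if there
    is none and the points are dependent, moving along the kernel creates one without changing any
    block weight. *)
Lemma reduce_support (R : realType) (I : finType) n (T : finType)
    (B : I -> {set T}) (w : T -> R) :
  (#|T| <= n)%N -> (forall x y, 0 < codeg B x y)%N -> normalised w ->
  exists (T' : finType) (B' : I -> {set T'}) (w' : T' -> R),
    [/\ forall x y, (0 < codeg B' x y)%N, normalised w', forall x, 0 < w' x,
        forall i, weight w' (B' i) = weight w (B i) & independent R B'].
Proof.
elim: n T B w => [|n IHn] T B w cT cov nw.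
  have := sum_normalised nw; rewrite big1 => [/esym/eqP|x _]; first by rewrite oner_eq0.
  by move: (max_card (pred1 x)); rewrite card1 => /leq_trans/(_ cT).
have zero_case u x : normalised u -> u x = 0 ->
    exists (T' : finType) (B' : I -> {set T'}) (w' : T' -> R),
    [/\ forall x y, (0 < codeg B' x y)%N, normalised w', forall x, 0 < w' x,
        forall i, weight w' (B' i) = weight u (B i) & independent R B'].
  (* Blocks are cut down to the remaining points. The index type stays the same, hence so does the
     number of blocks, even if some traces coincide. *)
  move=> nu ux0; pose T' : finType := {y | y \in [set~ x]%SET}.
  pose B' (i : I) : {set T'} := [set y | val y \in B i]%SET.
  have sub (A : {set T}) :
      weight (fun y : T' => u (val y)) [set y | val y \in A]%SET = weight u A.
    rewrite /weight.
    rewrite (eq_bigl (fun y : T' => val y \in A)); last by move=> y; rewrite inE.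
    rewrite -(big_sub_cond [in [set~ x]%SET] [in A] u) /=.
    rewrite [RHS](bigID [in [set~ x]%SET]) /= [X in _ + X]big1 ?addr0.
      by apply: eq_bigl => y; rewrite andbC.
    by move=> y /andP[_]; rewrite !inE negbK => /eqP ->.
  have [|y z||T2 [B2 [w2 [c2 n2 p2 e2 i2]]]] := IHn T' B' (fun y => u (val y)).
  - rewrite card_sig -ltnS; apply: leq_trans cT.
    by rewrite (cardD1 x [pred _ | true]) /= add1n ltnS; apply: subset_leq_card;
      apply/fintype.subsetP => y; rewrite !inE andbT.
  - by apply: leq_trans (cov (val y) (val z)) _; apply: leq_sum => i _; rewrite !inE.
  - split=> [y|]; first exact: nu.1.
    by rewrite -nu.2 -(sub [set: T]%SET); congr weight; apply/setP => y; rewrite !inE.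
  - by exists T2, B2, w2; split=> // i; rewrite e2 sub.
have [[x wx0]|nz] := pselect (exists x, w x = 0); first exact: zero_case nw wx0.
have wp x : 0 < w x.
  by rewrite lt_neqAle nw.1 andbT eq_sym; apply/eqP => e; apply: nz; exists x.
have [ind|] := pselect (independent R B); first by exists T, B, w.
move=> /existsNP[v] /not_implyP[sv] /not_implyP[vB] /existsNP[x0 /eqP vx0].
have [t [x [w20 w2x]]] := perturb_to_zero wp sv vx0.
have w2A A : weight (fun y => w y + t * v y) A = weight w A + t * weight v A.
  by rewrite /weight big_split -mulr_sumr.
have [|T2 [B2 [w2 [c2 n2 p2 e2 i2]]]] := zero_case (fun y => w y + t * v y) x _ w2x.
  split=> //; rewrite w2A nw.2 [weight v _](_ : _ = 0) ?mulr0 ?addr0 //.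
  by rewrite -sv; apply: eq_bigl => y; rewrite inE.
by exists T2, B2, w2; split=> // i; rewrite e2 w2A vB mulr0 addr0.
Qed.

Lemma card_sum_mem (T : finType) (A : {set T}) : #|A| = (\sum_x (x \in A))%N.
Proof. by rewrite -sum1_card big_mkcond; apply: eq_bigr => x _; case: ifP. Qed.

(** * Structure of independent optimal designs with [s ^ 2 + s] blocks *)

Section NearAffine.
Variables (R : realType) (T I : finType) (B : I -> {set T}).
Variables (s : nat) (w : T -> R).
Hypothesis s_gt1 : (1 < s)%N.
Hypothesis cardI : #|I| = (s ^ 2 + s)%N.
Hypothesis cov : forall x y, (0 < codeg B x y)%N.
Hypothesis degE : forall x, codeg B x x = s.+1.
Hypothesis nw : normalised w.
Hypothesis w_gt0 : forall x, 0 < w x.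
Hypothesis wB : forall i, weight w (B i) = 1 / s%:R.
Hypothesis ind : independent R B.

Let s_neq0 : s%:R != 0 :> R.
Proof. by rewrite pnatr_eq0 -lt0n ltnW. Qed.

Lemma codeg_ge x y : (1 + s * (x == y) <= codeg B x y)%N.
Proof. by case: eqVneq => [->|_]; rewrite ?muln0 ?muln1 // degE. Qed.

Lemma sum_codeg_lower (A : {set T}) y :
  (\sum_(x in A) (1 + s * (x == y)) = #|A| + s * (y \in A))%N.
Proof.
rewrite big_split /= sum1_card -big_distrr /=; congr (_ + s * _)%N.
rewrite big_mkcond (bigD1 y) //= eqxx big1 => [|x /negbTE ->].
  by rewrite addn0; case: ifP.
by case: ifP.
Qed.

(** Surplus of the codegrees over the minimum forced by covering and by the degree [s.+1]; [excessE]
    shows that the subtraction is never truncated. *)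
Definition excess (A : {set T}) y : nat :=
  (\sum_(x in A) codeg B x y - (#|A| + s * (y \in A)))%N.

Lemma excessE (A : {set T}) y :
  (\sum_(x in A) codeg B x y = excess A y + (#|A| + s * (y \in A)))%N.
Proof.
rewrite subnK // -sum_codeg_lower.
by apply: leq_sum => x _; exact: codeg_ge.
Qed.

(** Each [x] in [B i] contributes [s.+1 / s], the weight of its [s.+1] blocks. The forced part is
    [#|B i| + s * w (B i) = #|B i| + 1]. *)
Lemma sum_excess i :
  \sum_y (excess (B i) y)%:R * w y = #|B i|%:R / s%:R - 1.
Proof.
have : \sum_y (\sum_(x in B i) codeg B x y)%N%:R * w y = #|B i|%:R * (s.+1%:R / s%:R).
  under eq_bigr => y _ do rewrite natr_sum mulr_suml.
  rewrite exchange_big /= mulr_natl -sumr_const.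
  apply: eq_bigr => x _; rewrite -sum_weight_point -(degE x) codegxx natr_sum mulr_suml.
  by apply: eq_bigr => j _; rewrite wB mul1r.
under eq_bigr => y _ do rewrite excessE !natrD natrM !mulrDl.
rewrite !big_split /= -mulr_sumr (sum_normalised nw) mulr1.
have -> : \sum_y s%:R * (y \in B i)%:R * w y = 1.
  transitivity (s%:R * weight w (B i)); last by rewrite wB mulrCA mulfV // mulr1.
  rewrite /weight [in RHS]big_mkcond mulr_sumr; apply: eq_bigr => y _.
  by rewrite -mulrA; case: ifP; rewrite ?mul1r ?mul0r ?mulr0.
have -> : #|B i|%:R * (s.+1%:R / s%:R) = #|B i|%:R / s%:R + #|B i|%:R :> R.
  by rewrite -natr1; field.
lra.
Qed.

Lemma block_card_ge i : (s <= #|B i|)%N.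
Proof.
rewrite -(ler_nat R) -[leLHS]mul1r -ler_pdivlMr ?ltr0n 1?ltnW // -subr_ge0 -sum_excess.
by apply: sumr_ge0 => y _; rewrite mulr_ge0 // ltW.
Qed.

Lemma sum_block_card : (\sum_i #|B i| = #|T| * s.+1)%N.
Proof.
under eq_bigr => i _ do rewrite card_sum_mem.
rewrite exchange_big /= -sum_nat_const; apply: eq_bigr => x _.
by rewrite -(degE x) codegxx.
Qed.

Section SmallBlock.
Variable i : I.
Hypothesis Bi : #|B i| = s.

(** For a block of size [s] the weighted excess is zero. All weights being positive, every codegree
    with a point of the block attains its lower bound. *)
Lemma small_block_codeg x y : x \in B i -> codeg B x y = (1 + s * (x == y))%N.
Proof.
have /eqP : \sum_z (excess (B i) z)%:R * w z = 0 by rewrite sum_excess Bi divff // subrr.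
rewrite psumr_eq0; last by move=> z _; rewrite mulr_ge0 // ltW.
move=> /allP/(_ y); rewrite mem_index_enum mulf_eq0 (gt_eqF (w_gt0 y)) orbF.
rewrite pnatr_eq0 => /(_ isT)/eqP e0 xi.
have := excessE (B i) y; rewrite e0 add0n -sum_codeg_lower.
rewrite (bigD1 x) //= [RHS](bigD1 x) //= => h.
have : (\sum_(z in B i | z != x) (1 + s * (z == y))
         <= \sum_(z in B i | z != x) codeg B z y)%N.
  by apply: leq_sum => z _; exact: codeg_ge.
have := codeg_ge x y; lia.
Qed.

(** The parallel class of [i], with [i] itself included. *)
Definition parallels : {set I} := [set j | (j == i) || [disjoint B j & B i]].

(** Two common points of [B i] and another block would have codegree at least 2. *)
Lemma card_meet j : #|B j :&: B i| = ((j \notin parallels) + s * (j == i))%N.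
Proof.
rewrite inE; case: (eqVneq j i) => [->|ji] /=; first by rewrite finset.setIid Bi muln1.
rewrite muln0 addn0; have [dis|meet] /= := boolP [disjoint B j & B i].
  by apply/eqP; rewrite cards_eq0 finset.setI_eq0.
apply/eqP; rewrite eqn_leq card_gt0 finset.setI_eq0 meet andbT leqNgt.
apply/negP => /card_gt1P[x [y []]]; rewrite !inE => /andP[xj xi] /andP[yj yi] xy.
have := small_block_codeg y xi; rewrite (negbTE xy) muln0 addn0 /codeg.
by rewrite (bigD1 i) //= (bigD1 j) //= xi yi xj yj.
Qed.

(** The pairs of a block [j] through [x] and a point of [B j :&: B i] are counted by codegrees and
    by intersection sizes. Hence [s] of the [s.+1] blocks through [x] are not parallel to [i], which
    leaves one. *)
Lemma parallels_point x : (\sum_j (j \in parallels) * (x \in B j) = 1)%N.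
Proof.
have e1 : (\sum_j (x \in B j) * #|B j :&: B i| = s + s * (x \in B i))%N.
  rewrite -{1}Bi -sum_codeg_lower.
  rewrite (eq_bigr (fun j => \sum_(y in B i) (x \in B j) * (y \in B j)))%N.
    rewrite exchange_big /=; apply: eq_bigr => y yi.
    by rewrite -(small_block_codeg x yi) codegC.
  move=> j _; rewrite -big_distrr /=; congr (_ * _)%N.
  rewrite card_sum_mem [RHS]big_mkcond; apply: eq_bigr => y _.
  by rewrite inE andbC; case: (y \in B i).
have e2 : (\sum_j (x \in B j) * #|B j :&: B i|
           = \sum_j (x \in B j) * (j \notin parallels) + s * (x \in B i))%N.
  under eq_bigr => j _ do rewrite card_meet mulnDr.
  rewrite big_split /=; congr (_ + _)%N.
  rewrite (bigD1 i) //= eqxx big1 ?addn0; first by rewrite muln1 mulnC.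
  by move=> j /negbTE ->; rewrite !muln0.
have := degE x; rewrite codegxx.
rewrite (eq_bigr (fun j => (x \in B j) * (j \notin parallels)
                           + (j \in parallels) * (x \in B j)))%N.
  rewrite big_split /=; lia.
by move=> j _; case: (x \in B j); case: (j \in parallels).
Qed.

(** The points of [B i] lie on [s * s.+1] blocks with multiplicity. Block [i] accounts for [s] of
    these and each nonparallel block for one, so [s ^ 2] blocks are not parallel. *)
Lemma card_parallels : #|parallels| = s.
Proof.
have e1 : (\sum_j #|B j :&: B i| = s * s.+1)%N.
  rewrite -{1}Bi -sum_nat_const.
  rewrite (eq_bigr (fun j => \sum_(y in B i) (y \in B j)))%N.
    rewrite exchange_big /=; apply: eq_bigr => y yi.
    by rewrite -(degE y) codegxx.
  move=> j _; rewrite card_sum_mem [RHS]big_mkcond; apply: eq_bigr => y _.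
  by rewrite inE andbC; case: (y \in B i).
have e2 : (\sum_j #|B j :&: B i| = #|~: parallels| + s)%N.
  under eq_bigr => j _ do rewrite card_meet.
  rewrite big_split /=; congr (_ + _)%N.
    by rewrite card_sum_mem; apply: eq_bigr => j _; rewrite [in RHS]inE.
  rewrite -big_distrr /= (bigD1 i) //= eqxx big1 ?muln1 //.
  by move=> j /negbTE ->.
have := cardsC parallels; rewrite cardI; nia.
Qed.

End SmallBlock.

(** Blocks of size [s], any two of which meet; in an affine plane, representatives of distinct
    parallel classes. *)
Definition meeting_family (J : {set I}) : Prop :=
  (forall i, i \in J -> #|B i| = s) /\
  (forall i j, i \in J -> j \in J -> j \in parallels i -> j = i).

(* A weighting [v] killed by all blocks outside [J] has, for [i] in [J], total
   mass [v (B i)], as the parallels of [i] partition the points. Summing over all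
   blocks, [s + 1] times the total mass is [#|J|] times the total mass. *)
Lemma meeting_family_card_le (J : {set I}) :
  meeting_family J -> (#|J| <= s)%N -> (#|T| <= s ^ 2 + s - #|J|)%N.
Proof.
move=> [Js Jp] cJ.
rewrite (_ : (s ^ 2 + s - #|J| = #|~: J|)%N); last by rewrite -cardI -(cardsC J) addKn.
apply: (@card_le_blocks R _ _ B) => v vJ.
have vi i : i \in J -> weight v (B i) = \sum_x v x.
  move=> iJ; transitivity (\sum_j (j \in parallels i)%:R * weight v (B j)).
    rewrite (bigD1 i) //= [in RHS]inE eqxx mul1r big1 ?addr0 // => j ji.
    have [jp|] := boolP (j \in parallels i); last by rewrite mul0r.
    have [/(Jp _ _ iJ)/(_ jp) e|jJ] := boolP (j \in J); first by rewrite e eqxx in ji.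
    by rewrite vJ ?mulr0 // inE.
  rewrite (sum_weight B (fun j => (j \in parallels i) : nat)).
  by apply: eq_bigr => x _; rewrite parallels_point ?Js // mul1r.
have v0 : \sum_x v x = 0.
  have := sum_weight_all B v.
  under [RHS]eq_bigr => x _ do rewrite degE.
  rewrite -mulr_sumr (bigID [in J]) /= [X in _ + X]big1 ?addr0; last first.
    by move=> j jJ; rewrite vJ // inE.
  rewrite (eq_bigr _ vi) sumr_const -[_ *+ _]mulr_natl => /eqP.
  rewrite -subr_eq0 -mulrBl mulf_eq0 subr_eq0 eqr_nat.
  by case/orP => [/eqP e|/eqP //]; rewrite e ltnn in cJ.
apply: ind => // i; have [iJ|iJ] := boolP (i \in J); first by rewrite vi.
by rewrite vJ // inE.
Qed.

(** Few points force many blocks of size [s], more than the parallel classes of [J] can hold; one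
    outside these classes meets every member of [J]. *)
Lemma meeting_family_extend (J : {set I}) :
  meeting_family J -> (0 < #|J| <= s)%N ->
  exists2 J' : {set I}, meeting_family J' & #|J'| = #|J|.+1.
Proof.
move=> fJ /andP[J0 Js]; have cT := meeting_family_card_le fJ Js; case: fJ => [Jc Jp].
pose Z : {set I} := [set i | #|B i| == s].
(* Blocks outside [Z] have at least [s.+1] points, so [#|Z|] is at least the shortfall of the
   incidences [#|T| * s.+1] from [#|I| * s.+1]. *)
have cZ : (#|J| * s.+1 <= #|Z|)%N.
  have : (\sum_(i : I) s.+1 <= \sum_i (#|B i| + (i \in Z)))%N.
    apply: leq_sum => i _; have := block_card_ge i; rewrite inE; case: eqP => /=; lia.
  rewrite big_split /= sum_block_card -card_sum_mem sum_nat_const cardI; nia.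
pose U : {set I} := \bigcup_(i in J) parallels i.
have cU : (#|U| <= #|J| * s)%N.
  rewrite -sum_nat_const /U; elim/big_rec2: _ => [|i n A iJ cA]; first by rewrite cards0.
  by apply: leq_trans (leq_card_setU _ _) _; rewrite card_parallels ?Jc // leq_add2l.
(* Here [J] must be nonempty: then [#|J| * s.+1] exceeds [#|J| * s]. *)
have /card_gt0P[k] : (0 < #|Z :\: U|)%N.
  have := cardsID U Z; have := subset_leq_card (finset.subsetIr Z U); nia.
rewrite !inE => /andP[kU /eqP kZ].
have kp i : i \in J -> k \notin parallels i.
  by move=> iJ; apply: contra kU => ?; apply/finset.bigcupP; exists i.
have parC i j : (j \in parallels i) = (i \in parallels j).
  by rewrite !inE eq_sym disjoint_sym.
have kJ : k \notin J by apply/negP => /kp; rewrite inE eqxx.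
exists (k |: J); last by rewrite cardsU1 kJ.
split=> [i|i j]; rewrite !in_setU1; first by case/orP => [/eqP ->|/Jc].
case/orP => [/eqP ->|iJ] /orP[/eqP -> //|jJ].
- by rewrite parC (negbTE (kp _ jJ)).
- by rewrite (negbTE (kp _ iJ)).
- exact: Jp.
Qed.

(** One block of size [s] grows into a meeting family of [s] blocks, which bounds the points by
    [s ^ 2]. Without such a block, counting incidences leaves no slack in the bounds on points and
    block sizes. *)
Lemma near_affine_dichotomy :
  (#|T| <= s ^ 2)%N \/ (#|T| = (s ^ 2 + s)%N /\ forall i, #|B i| = s.+1).
Proof.
have [/existsP[i /eqP Bi]|nB] := boolP [exists i, #|B i| == s]; [left|right].
  have grow n : (n < s)%N -> exists2 J : {set I}, meeting_family J & #|J| = n.+1.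
    elim: n => [_|n IHn ns].
      exists [set i]; last by rewrite cards1.
      by split=> [j|j k]; rewrite !inE => /eqP -> // /eqP ->.
    have [J fJ cJ] := IHn (ltnW ns).
    by rewrite -cJ; apply: meeting_family_extend => //; rewrite cJ; exact: ltnW.
  have [J fJ cJ] := grow s.-1 ltac:(lia).
  have := meeting_family_card_le fJ; rewrite cJ; lia.
move: nB; rewrite negb_exists => /forallP nB.
have gB i : (s.+1 <= #|B i|)%N by rewrite ltn_neqAle eq_sym nB block_card_ge.
(* The empty meeting family gives the bound by the number of blocks. *)
have cT : (#|T| <= s ^ 2 + s)%N.
  have := @meeting_family_card_le finset.set0; rewrite cards0 subn0; apply => //.
  by split=> [j|j k]; rewrite inE.
have cT' : #|T| = (s ^ 2 + s)%N.
  have : (\sum_(i : I) s.+1 <= \sum_i #|B i|)%N by apply: leq_sum => i _.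
  rewrite sum_block_card sum_nat_const cardI; nia.
split=> // i; apply/eqP; rewrite eqn_leq gB andbT leqNgt; apply/negP => lt.
have : (\sum_(i : I) s.+1 < \sum_i #|B i|)%N.
  rewrite (bigD1 i) //= [X in (_ < X)%N](bigD1 i) //= -addSn leq_add //.
  by apply: leq_sum => j _.
by rewrite sum_block_card sum_nat_const cardI cT' ltnn.
Qed.

End NearAffine.

(** * Compactness: the optimal weight is attained *)

Section Attainment.
Local Open Scope classical_set_scope.
Import numFieldNormedType.Exports.

Lemma feasible_closed (R : realType) (T I : finType) (B : I -> {set T}) (L : R) :
  (forall e : R, 0 < e -> exists w : T -> R, feasible B (L + e) w) ->
  exists w : T -> R, feasible B L w.
Proof.
move=> approx.
pose wt (u : 'rV[R]_#|T|) x := u ord0 (enum_rank x).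
(* A penalty for violating the mass and block constraints. It is minimised over the unit cube, which
   takes care of nonnegativity; a minimum of zero is a feasible weighting. *)
pose f u := `|\sum_x wt u x - 1|
            + \sum_i Num.max 0 (weight (wt u) (B i) - L).
pose K := [set u : 'rV[R]_#|T| | forall k, `[0, 1] (u ord0 k)].
have cK : compact K.
  by apply: (@rV_compact R _ (fun=> `[0, 1])) => _; exact: segment_compact.
have cwt x : continuous (wt^~ x) by exact: coord_continuous.
have addc : continuous (fun z : R * R => z.1 + z.2) by exact: add_continuous.
have csum (P : pred T) : continuous (fun u => \sum_(x | P x) wt u x).
  by apply: (continuous_big addc) => x _; exact: cwt.
have cdef i : continuous (fun u => weight (wt u) (B i) - L).
  by move=> u; apply: continuousB; [exact: (csum [in B i])|exact: cst_continuous].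
have cmax : continuous (fun u => \sum_i Num.max 0 (weight (wt u) (B i) - L)).
  apply: (continuous_big addc) => i _ u.
  apply: (@continuous_max R _ (cst 0) (fun u => weight (wt u) (B i) - L)).
    exact: cst_continuous.
  exact: cdef.
have cf : continuous f.
  move=> u; apply: (@continuousD R R^o _ (fun u => `|\sum_x wt u x - 1|)
    (fun u => \sum_i Num.max 0 (weight (wt u) (B i) - L))); last exact: cmax.
  apply: (@continuous_comp _ _ _ (fun u => \sum_x wt u x - 1) Num.norm).
    by apply: continuousB; [exact: (csum xpredT)|exact: cst_continuous].
  exact: norm_continuous.
have fK e : 0 < e -> exists2 u, K u & f u <= #|I|%:R * e.
  move=> e0; have [w [nw wL]] := approx e e0.
  pose u : 'rV[R]_#|T| := \row_k w (enum_val k).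
  have uE : wt u = w by apply/funext => x; rewrite /wt mxE enum_rankK.
  exists u.
    move=> k; rewrite /= mxE in_itv /= nw.1 -(sum_normalised nw) /=.
    by rewrite (bigD1 (enum_val k)) //= lerDl sumr_ge0 // => y _; exact: nw.1.
  rewrite /f uE (sum_normalised nw) subrr normr0 add0r mulr_natl -sumr_const.
  by apply: ler_sum => i _; rewrite ge_max (ltW e0) /= lerBlDl.
have K0 : K !=set0 by have [u Ku _] := fK 1 ltr01; exists u.
have [u uK umin] := EVT_min_rV K0 cK (continuous_subspaceT cf).
have {uK} uK : K u by rewrite inE in uK.
have fu0 : f u <= 0.
  apply/ler_addgt0Pr => e e0; rewrite add0r.
  (* The successor keeps the divisor nonzero when there are no blocks. *)
  have [t Kt ft] := fK (e / #|I|.+1%:R) (divr_gt0 e0 (ltr0Sn _ _)).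
  apply: le_trans (umin t _) _; first by rewrite inE.
  apply: le_trans ft _; rewrite mulrCA ler_piMr ?ltW //.
  by rewrite ltr_pdivrMr ?ltr0Sn // mul1r ltr_nat.
have m0 i : 0 <= Num.max 0 (weight (wt u) (B i) - L) by rewrite le_max lexx.
have /eqP : f u = 0 by apply/eqP; rewrite eq_le fu0 addr_ge0 // sumr_ge0.
rewrite paddr_eq0 // ?sumr_ge0 // normr_eq0 subr_eq0 => /andP[/eqP s1].
rewrite psumr_eq0 // => /allP sB; exists (wt u); split; first split.
- by move=> x; have /= := uK (enum_rank x); rewrite in_itv /= => /andP[].
- by rewrite /weight -s1; apply: eq_bigl => x; rewrite inE.
- move=> i; have /eqP h := sB i (mem_index_enum _).
  by rewrite -subr_le0 -[leRHS]h le_max lexx orbT.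
Qed.

End Attainment.

(** * Passage between hypergraphs and indexed families of blocks *)

Section Hypergraphs.
Variable R : realType.

(** Indexing by position keeps repeated blocks apart, so that multiplicities are counted. *)
Definition block_at (D : hypergraph) (i : 'I_(nblocks D)) : {set Defs.point D} :=
  nth finset.set0 (blocks D) i.

Lemma codegreeE (D : hypergraph) (x y : Defs.point D) :
  codegree x y = codeg (@block_at D) x y.
Proof.
rewrite /codegree -sum1_count big_mkcond (big_nth finset.set0) big_mkord.
by apply: eq_bigr => i _; rewrite mulnb /block_at; case: (_ && _).
Qed.

Lemma degreeE (D : hypergraph) (x : Defs.point D) :
  degree x = codeg (@block_at D) x x.
Proof.
by rewrite -codegreeE; apply: eq_count => A; rewrite andbb.
Qed.

Lemma covering_codeg (D : hypergraph) :
  covering_design D <-> forall x y, (0 < codeg (@block_at D) x y)%N.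
Proof.
split=> [[d c] x y|c].
  by have [->|/eqP/c] := eqVneq x y; rewrite -?degreeE -?codegreeE.
by split=> [x|x y _]; rewrite ?degreeE ?codegreeE.
Qed.

Lemma uniform_block_at (D : hypergraph) k :
  (forall i, #|@block_at D i| = k) -> uniform k D.
Proof.
move=> h A AD; have AD' : (index A (blocks D) < nblocks D)%N by rewrite index_mem.
by rewrite -(h (Ordinal AD')) /block_at /= nth_index.
Qed.

Definition design_of (T I : finType) (B : I -> {set T}) : hypergraph :=
  Hypergraph [seq B i | i <- enum I].

Lemma nblocks_design_of (T I : finType) (B : I -> {set T}) :
  nblocks (design_of B) = #|I|.
Proof. by rewrite /nblocks size_map -cardE. Qed.

Lemma codegree_design_of (T I : finType) (B : I -> {set T}) (x y : T) :
  @codegree (design_of B) x y = codeg B x y.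
Proof.
rewrite /codegree -sum1_count big_map big_enum_cond /= big_mkcond.
by apply: eq_bigr => i _; rewrite mulnb; case: (_ && _).
Qed.

Lemma degree_design_of (T I : finType) (B : I -> {set T}) (x : T) :
  @degree (design_of B) x = codeg B x x.
Proof.
by rewrite -codegree_design_of; apply: eq_count => A; rewrite andbb.
Qed.

Lemma uniform_design_of (T I : finType) (B : I -> {set T}) k :
  (forall i, #|B i| = k) -> uniform k (design_of B).
Proof. by move=> h A /mapP[i _ ->]. Qed.

Lemma feasible_max (D : hypergraph) (w : Defs.point D -> R) (L : R) :
  normalised w -> max_block_weight w <= L -> feasible (@block_at D) L w.
Proof.
move=> nw wL; split=> // i; apply: le_trans wL.
by apply: le_bigmax_seq => //; rewrite mem_nth.
Qed.

Lemma Ldesign_attained (D : hypergraph) (L : R) :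
  Ldesign R D = L%:E -> exists w : Defs.point D -> R, feasible (@block_at D) L w.
Proof.
move=> DL; apply: feasible_closed => e e0.
have : (Ldesign R D < (L + e)%:E)%E by rewrite DL lte_fin ltrDl.
by move=> /ereal_inf_lt[_ [w nw <-]]; rewrite lte_fin => /ltW/(feasible_max nw); exists w.
Qed.

(* Merging the points that lie on the same blocks leaves, for [m] blocks, only
   finitely many designs: the intersecting families of subsets of ['I_m]. *)
Lemma Lnum_attained m (L : R) : Lnum R m = L%:E ->
  exists (T : finType) (B : 'I_m -> {set T}) (w : T -> R),
    (forall x y, 0 < codeg B x y)%N /\ feasible B L w.
Proof.
move=> ml.
pose T (S : {set {set 'I_m}}) : finType := {x | x \in S}.
pose B S (i : 'I_m) : {set T S} := [set x : T S | i \in sval x].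
pose cov S := forall x y, (0 < codeg (B S) x y)%N.
apply: contrapT => none.
(* If no design attains [L], each covering family [S] misses it by a margin [e S]. As there are
   finitely many families, the least margin [e0] serves for all of them. *)
have /choice[e eP] S : exists e : R, 0 < e /\
    (cov S -> ~ exists w : T S -> R, feasible (B S) (L + e) w).
  apply: contrapT => /forallNP h.
  have covS : cov S by apply: contrapT => ncov; apply: (h 1); split.
  apply: none; exists (T S), (B S).
  have [|w fw] := @feasible_closed R _ _ (B S) L; last by exists w.
  by move=> e e0; apply: contrapT => nw; apply: (h e).
pose e0 := \big[Num.min/1]_S e S.
have e0_gt0 : 0 < e0 by apply: lt_bigmin => // S _; exact: (eP S).1.
have : (Lnum R m < (L + e0)%:E)%E by rewrite ml lte_fin ltrDl.
case/ereal_inf_lt => _ [D [cD nD ->]] /ereal_inf_lt[_ [w nw <-]].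
rewrite lte_fin => /ltW/(feasible_max nw)[_ fw]; move/covering_codeg: cD => cD.
case: m / nD @T @B @cov none e eP @e0 e0_gt0 fw {ml} => T B cov none e eP e0 e0_gt0 fw.
pose tr (x : Defs.point D) : {set 'I_(nblocks D)} := [set i | x \in block_at i].
pose S := tr @: [set: Defs.point D]%SET.
have trS x : tr x \in S by apply: imset_f; rewrite inE.
pose tr' (x : Defs.point D) : T S := exist _ (tr x) (trS x).
have trB x i : (tr' x \in B S i) = (x \in block_at i) by rewrite !inE.
have [] := (eP S).2.
  move=> [a aS] [b bS]; have /imsetP[x _ ax] := aS; have /imsetP[y _ yb] := bS.
  apply: leq_trans (cD x y) _; apply: leq_sum => i _.
  by rewrite !inE /= ax yb !inE.
pose w' (a : T S) : R := \sum_(x | tr' x == a) w x.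
have w'A (A : {set T S}) : weight w' A = \sum_(x | tr' x \in A) w x.
  rewrite /weight /w' [RHS](partition_big tr' [in A]) //=.
  apply: eq_bigr => a aA; apply: eq_bigl => x.
  by case: eqVneq => [->|]; rewrite ?aA ?andbF.
exists w'; split; first split.
- by move=> a; apply: sumr_ge0 => x _; exact: nw.1.
- by rewrite w'A -(sum_normalised nw); apply: eq_bigl => x; rewrite inE.
- move=> i; rewrite w'A (eq_bigl [in block_at i]) => [|x]; last by rewrite trB.
  by apply: le_trans (fw i) _; rewrite lerD2l; exact: bigmin_le.
Qed.

(** Witnessed by the uniform weighting. *)
Lemma Lnum_le_uniform (D : hypergraph) k :
  covering_design D -> uniform k D -> (0 < npoints D)%N ->
  (Lnum R (nblocks D) <= (k%:R / (npoints D)%:R)%:E)%E.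
Proof.
move=> cD uD n0; apply: ge_ereal_inf.
exists (Ldesign R D); first by exists D.
have n0' : (npoints D)%:R != 0 :> R by rewrite pnatr_eq0 -lt0n.
apply: ge_ereal_inf; exists (@max_block_weight R D (fun=> (npoints D)%:R^-1))%:E.
  exists (fun=> (npoints D)%:R^-1) => //; split=> [x|]; first by rewrite invr_ge0.
  by rewrite /weight sumr_const cardsT -[_ *+ _]mulr_natl mulfV.
rewrite lee_fin /max_block_weight big_seq; apply: bigmax_le => [|A /uD Ak].
  by rewrite divr_ge0.
by rewrite /weight sumr_const Ak mulr_natl.
Qed.

(** Rigidity at [L] gives the lower bound: a weighting with all blocks below [L] is feasible for
    [L], so its blocks would weigh exactly [L]. A block exists because [m] is positive. *)
Lemma Lnum_ge m (L : R) : (0 < m)%N ->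
  (forall D : hypergraph, covering_design D -> nblocks D = m ->
     forall w : Defs.point D -> R, feasible (@block_at D) L w ->
     forall i, weight w (@block_at D i) = L) ->
  (L%:E <= Lnum R m)%E.
Proof.
move=> m0 tight; apply: le_ereal_inf_tmp => _ [D [cD nD ->]].
apply: le_ereal_inf_tmp => _ [w nw <-]; rewrite lee_fin leNgt; apply/negP => lt.
have fw := feasible_max nw (ltW lt).
have i0 : 'I_(nblocks D) by rewrite nD; exact: Ordinal m0.
move: lt; rewrite -(tight D cD nD w fw i0) ltNge => /negP; apply.
by apply: le_bigmax_seq => //; rewrite mem_nth.
Qed.

End Hypergraphs.

(** With constant degree [k] the block weights sum to [k] times the total mass, so a [v] vanishing
    on all blocks has total mass zero. *)
Lemma independent_card_le (R : realType) (T I : finType) (B : I -> {set T}) k :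
  (0 < k)%N -> (forall x, codeg B x x = k) -> independent R B -> (#|T| <= #|I|)%N.
Proof.
move=> k0 deg ind; rewrite -[leqRHS]cardsT; apply: (@card_le_blocks R _ _ B) => v vB.
apply: ind => [|i]; last by apply: vB; rewrite inE.
have := sum_weight_all B v; rewrite big1 => [|i _]; last by apply: vB; rewrite inE.
under eq_bigr => x _ do rewrite deg.
rewrite -mulr_sumr => /esym/eqP; rewrite mulf_eq0 pnatr_eq0 (gtn_eqF k0) /=.
by move/eqP.
Qed.

(** * Projective planes *)

Section Projective.
Variables (R : realType) (s : nat).
Hypothesis s_gt0 : (0 < s)%N.

Let N := (s ^ 2 + s + 1)%N.
Let L : R := (s + 1)%:R / N%:R.
Let c : R := N%:R^-1.

Let N_gt0 : 0 < N%:R :> R.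
Proof. by rewrite ltr0n /N addn1. Qed.

Let N_neq0 : N%:R != 0 :> R.
Proof. by rewrite gt_eqF. Qed.

Let Lc : s.+1%:R * L = 1 + s%:R * c.
Proof.
rewrite /L /c -[s.+1]addn1; move: N_neq0; rewrite /N !natrD natrX => ?; field.
by rewrite -natrX.
Qed.

Let Nc : N%:R * c = 1.
Proof. exact: mulfV. Qed.

Let c_ge0 : 0 <= c.
Proof. by rewrite invr_ge0 ltW. Qed.

Section Design.
Variables (T I : finType) (B : I -> {set T}) (w : T -> R).
Hypothesis cov : forall x y, (0 < codeg B x y)%N.
Hypothesis fw : feasible B L w.

(** A degree of at most [s] makes the right side of [degree_weight_le] at most
    [s * (s + 1) / N < 1], while the left side is at least 1. *)
Lemma projective_degree x : 0 < w x -> (s < codeg B x x)%N.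
Proof.
move=> wx; rewrite ltnNge; apply/negP => le_ds.
have := degree_weight_le cov x fw; apply/negP; rewrite -ltNge.
have d1 : 1 <= (codeg B x x)%:R :> R by rewrite ler1n.
have : (codeg B x x)%:R * L < 1.
  rewrite mulrA ltr_pdivrMr // mul1r -natrM ltr_nat /N.
  by apply: leq_ltn_trans (leq_mul le_ds (leqnn _)) _; lia.
have : 0 <= ((codeg B x x)%:R - 1) * w x by rewrite mulr_ge0 ?subr_ge0 // ltW.
lra.
Qed.

Hypothesis cardI : #|I| = N.

Lemma projective_IL : #|I|%:R * L = s.+1%:R.
Proof. by rewrite cardI mulrC divfK // addn1. Qed.

Lemma projective_block i : weight w (B i) = L.
Proof. exact: (tight_block projective_IL fw projective_degree). Qed.

Hypothesis cardT : (#|T| <= N)%N.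

Lemma projective_card : #|T| = N.
Proof.
exact: (tight_card cov projective_IL Lc s_gt0 c_ge0 fw projective_degree Nc cardT).
Qed.

Lemma projective_block_card i : #|B i| = s.+1.
Proof.
apply/eqP; rewrite -(eqr_nat R).
rewrite (tight_block_card cov projective_IL Lc s_gt0 c_ge0 fw projective_degree Nc cardT).
by rewrite mulrC divfK // addn1.
Qed.

Lemma projective_codeg x y : x != y -> codeg B x y = 1%N.
Proof.
exact: (tight_codeg cov projective_IL Lc s_gt0 c_ge0 fw projective_degree Nc cardT).
Qed.

End Design.

Lemma projective_plane_feasible (D : hypergraph) (w : Defs.point D -> R) :
  covering_design D -> nblocks D = N -> (npoints D <= N)%N ->
  feasible (@block_at D) L w -> projective_plane s D.
Proof.
move=> /[dup] cD /covering_codeg cov nD pD fw.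
have cI : #|'I_(nblocks D)| = N by rewrite card_ord.
split=> //.
- by split=> // x y /eqP xy; rewrite codegreeE (projective_codeg cov fw cI).
- by apply: uniform_block_at => i; rewrite (projective_block_card cov fw cI).
- exact: (projective_card cov fw cI).
Qed.

Lemma Lnum_projective_ge : (L%:E <= Lnum R N)%E.
Proof.
apply: Lnum_ge => [|D /covering_codeg cov nD w fw i]; first by rewrite /N addn1.
by apply: (projective_block cov fw); rewrite card_ord.
Qed.

(** After reduction of an optimum all degrees are [s.+1], so independence bounds the points by [N]
    and the rigidity for few points applies. *)
Lemma projective_of_Lnum : Lnum R N = L%:E -> exists D, projective_plane s D.
Proof.
move=> /Lnum_attained[T [B [w [cov fw]]]].
have [T' [B' [w' [cov' nw' w'0 w'B ind]]]] := reduce_support (leqnn _) cov fw.1.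
have fw' : feasible B' L w' by split=> // i; rewrite w'B; exact: fw.2.
have cI : #|'I_N| = N by rewrite card_ord.
have deg x : codeg B' x x = s.+1.
  exact: (tight_degree (projective_IL cI) fw' (projective_degree cov' fw') (w'0 x)).
have cT : (#|T'| <= N)%N by rewrite -cI; exact: independent_card_le deg ind.
exists (design_of B'); split=> //.
- split; first split=> x => [|y _].
  + by rewrite degree_design_of.
  + by rewrite codegree_design_of.
  + by move=> x y /eqP xy; rewrite codegree_design_of (projective_codeg cov' fw' cI).
- by apply: uniform_design_of => i; rewrite (projective_block_card cov' fw' cI).
- exact: (projective_card cov' fw' cI).
- by rewrite nblocks_design_of.
Qed.

Lemma Lnum_of_projective D : projective_plane s D -> Lnum R N = L%:E.
Proof.
move=> [_ [cD _] uD pD nD]; apply/eqP; rewrite eq_le Lnum_projective_ge andbT.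
have -> : L = s.+1%:R / (npoints D)%:R by rewrite pD /L -[s.+1]addn1.
by rewrite /N -nD; apply: Lnum_le_uniform => //; rewrite pD addn1.
Qed.

End Projective.

(** * Affine and almost projective planes *)

Section Affine.
Variables (R : realType) (s : nat).
Hypothesis s_gt1 : (1 < s)%N.

Let L : R := 1 / s%:R.
Let c : R := (s ^ 2)%N%:R^-1.

Let s_gt0 : (0 < s)%N := ltnW s_gt1.

Let s_gt0R : 0 < s%:R :> R.
Proof. by rewrite ltr0n. Qed.

Let s_neq0 : s%:R != 0 :> R.
Proof. by rewrite gt_eqF. Qed.

Let Lc : s.+1%:R * L = 1 + s%:R * c.
Proof. by rewrite /L /c natrX -natr1; field. Qed.

Let Nc : (s ^ 2)%N%:R * c = 1.
Proof. by rewrite mulfV // natrX expf_neq0. Qed.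

Let c_ge0 : 0 <= c.
Proof. by rewrite invr_ge0. Qed.

Section Design.
Variables (T I : finType) (B : I -> {set T}) (w : T -> R).
Hypothesis cov : forall x y, (0 < codeg B x y)%N.
Hypothesis fw : feasible B L w.

(** A degree [d <= s] only gives [d * L <= 1], with equality possible; the term [(d - 1) * w x]
    supplies strictness once [d] is at least 2. *)
Lemma affine_degree x : 0 < w x -> (s < codeg B x x)%N.
Proof.
move=> wx; rewrite ltnNge; apply/negP => le_ds.
have := degree_weight_le cov x fw; apply/negP; rewrite -ltNge.
rewrite /L mul1r ltr_pdivrMr // mulrDl mul1r.
have dR : (codeg B x x)%:R <= s%:R :> R by rewrite ler_nat.
(* In degree 1 that term vanishes and strictness comes from [1 < s]. *)
have [d1|d1] := leqP (codeg B x x) 1.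
  have -> : codeg B x x = 1%N by apply/eqP; rewrite eqn_leq d1 cov.
  by rewrite subrr !mul0r addr0 ltr_nat.
rewrite (le_lt_trans dR) // ltrDl !mulr_gt0 // subr_gt0.
by rewrite -[1]/(1%:R) ltr_nat.
Qed.

Hypothesis cardI : #|I| = (s ^ 2 + s)%N.

Lemma affine_IL : #|I|%:R * L = s.+1%:R.
Proof. by rewrite cardI /L natrD natrX -natr1; field. Qed.

Lemma affine_block i : weight w (B i) = L.
Proof. exact: (tight_block affine_IL fw affine_degree). Qed.

Hypothesis cardT : (#|T| <= s ^ 2)%N.

Lemma affine_card : #|T| = (s ^ 2)%N.
Proof.
exact: (tight_card cov affine_IL Lc s_gt0 c_ge0 fw affine_degree Nc cardT).
Qed.

Lemma affine_block_card i : #|B i| = s.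
Proof.
apply/eqP; rewrite -(eqr_nat R).
rewrite (tight_block_card cov affine_IL Lc s_gt0 c_ge0 fw affine_degree Nc cardT).
by apply/eqP; rewrite /L natrX; field.
Qed.

Lemma affine_codeg x y : x != y -> codeg B x y = 1%N.
Proof.
exact: (tight_codeg cov affine_IL Lc s_gt0 c_ge0 fw affine_degree Nc cardT).
Qed.

End Design.

Lemma affine_plane_feasible (D : hypergraph) (w : Defs.point D -> R) :
  covering_design D -> nblocks D = (s ^ 2 + s)%N -> (npoints D <= s ^ 2)%N ->
  feasible (@block_at D) L w -> affine_plane s D.
Proof.
move=> /[dup] cD /covering_codeg cov nD pD fw.
have cI : #|'I_(nblocks D)| = (s ^ 2 + s)%N by rewrite card_ord.
split=> //.
- by split=> // x y /eqP xy; rewrite codegreeE (affine_codeg cov fw cI).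
- by apply: uniform_block_at => i; rewrite (affine_block_card cov fw cI).
- exact: (affine_card cov fw cI).
Qed.

Lemma Lnum_affine_ge : (L%:E <= Lnum R (s ^ 2 + s))%E.
Proof.
apply: Lnum_ge => [|D /covering_codeg cov nD w fw i]; first by lia.
by apply: (affine_block cov fw); rewrite card_ord.
Qed.

Lemma affine_of_Lnum : Lnum R (s ^ 2 + s) = L%:E ->
  (exists D, affine_plane s D) \/ (exists D, almost_projective_plane s D).
Proof.
move=> /Lnum_attained[T [B [w [cov fw]]]].
have [T' [B' [w' [cov' nw' w'0 w'B ind]]]] := reduce_support (leqnn _) cov fw.1.
have fw' : feasible B' L w' by split=> // i; rewrite w'B; exact: fw.2.
have cI : #|'I_(s ^ 2 + s)| = (s ^ 2 + s)%N by rewrite card_ord.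
have deg x : codeg B' x x = s.+1.
  exact: (tight_degree (affine_IL cI) fw' (affine_degree cov' fw') (w'0 x)).
have wB i := affine_block cov' fw' cI i.
have cD : covering_design (design_of B').
  by split=> [x|x y _]; rewrite ?degree_design_of ?codegree_design_of.
have [cT|[cT B's]] := near_affine_dichotomy s_gt1 cI cov' deg nw' w'0 wB ind.
- left; exists (design_of B'); split=> //.
  + by split=> // x y /eqP xy; rewrite codegree_design_of (affine_codeg cov' fw' cI).
  + by apply: uniform_design_of => i; rewrite (affine_block_card cov' fw' cI).
  + exact: (affine_card cov' fw' cI).
  + by rewrite nblocks_design_of.
- right; exists (design_of B'); split=> //.
  + exact: uniform_design_of.
  + by rewrite nblocks_design_of.
  + by move=> x; rewrite degree_design_of.
Qed.

(** Under uniform weights both kinds of plane have block weight [1 / s]: it is [s / s ^ 2] in one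
    case and [s.+1 / (s ^ 2 + s)] in the other. *)
Lemma Lnum_of_affine :
  (exists D, affine_plane s D) \/ (exists D, almost_projective_plane s D) ->
  Lnum R (s ^ 2 + s) = L%:E.
Proof.
move=> planes; apply/eqP; rewrite eq_le Lnum_affine_ge andbT.
case: planes => [[D [_ [cD _] uD pD nD]]|[D [cD uD pD nD _]]].
  have -> : L = s%:R / (npoints D)%:R by rewrite pD /L natrX; field.
  by rewrite -nD; apply: Lnum_le_uniform => //; rewrite pD expn_gt0 s_gt0.
have -> : L = s.+1%:R / (npoints D)%:R.
  rewrite pD /L natrD natrX -natr1; field.
  by rewrite s_neq0 expr2 -[X in _ + X]mul1r -mulrDl mulf_neq0 // natr1 pnatr_eq0.
by rewrite -nD; apply: Lnum_le_uniform => //; rewrite pD; lia.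
Qed.

End Affine.

Theorem theorem1p2 (R : realType) :
  (forall s : nat, (1 <= s)%N ->
    (Lnum R (s ^ 2 + s + 1) = ((s + 1)%:R / (s ^ 2 + s + 1)%:R)%:E <->
     exists D : hypergraph, projective_plane s D) /\
    (forall D : hypergraph,
       covering_design D ->
       nblocks D = (s ^ 2 + s + 1)%N ->
       (npoints D <= s ^ 2 + s + 1)%N ->
       Ldesign R D = ((s + 1)%:R / (s ^ 2 + s + 1)%:R)%:E ->
       projective_plane s D)) /\
  (forall s : nat, (2 <= s)%N ->
    (Lnum R (s ^ 2 + s) = (1 / s%:R)%:E <->
     (exists D : hypergraph, affine_plane s D) \/
     (exists D : hypergraph, almost_projective_plane s D)) /\
    (forall D : hypergraph,
       covering_design D ->
       nblocks D = (s ^ 2 + s)%N ->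
       (npoints D <= s ^ 2)%N ->
       Ldesign R D = (1 / s%:R)%:E ->
       affine_plane s D)).
Proof.
split=> s hs; split.
- split; first exact: projective_of_Lnum.
  by move=> [D]; exact: Lnum_of_projective.
- by move=> D cD nD pD /Ldesign_attained[w]; exact: projective_plane_feasible.
- split; [exact: affine_of_Lnum|exact: Lnum_of_affine].
- by move=> D cD nD pD /Ldesign_attained[w]; exact: affine_plane_feasible.
Qed.
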